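(* Let $\mathcal{A} \subset \omega^\omega$ be a MAD family and let $\mathcal{I}_0(\mathcal{A}) = \{a \subset \omega : \exists p \in \omega^a\ \forall h \in \mathcal{A}\ [|p \cap h| < \omega]\}$. If $[\omega]^\omega \setminus \mathcal{I}_0(\mathcal{A})$ is a P-coideal, i.e. for every sequence $a_0 \supset a_1 \supset \dots$ of sets in $[\omega]^\omega \setminus \mathcal{I}_0(\mathcal{A})$ there is $a \in [\omega]^\omega \setminus \mathcal{I}_0(\mathcal{A})$ with $a \subset^* a_n$ for all $n$, then $\mathcal{A}$ is not analytic.
   Context: Functions (including partial functions $p \in \omega^a$, $a\subset\omega$) are identified with their graphs (subsets of $\omega\times\omega$). An a.d. family $\mathcal{A}\subset\omega^\omega$ is one with $|f\cap g|<\omega$ for distinct $f,g\in\mathcal{A}$; it is a MAD family in $\omega^\omega$ if moreover every $f\in\omega^\omega$ satisfies $|f\cap h|=\omega$ for some $h\in\mathcal{A}$. $x \subset^* y$ means $x\setminus y$ is finite. Analytic refers to the Baire space topology on $\omega^\omega$. *)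

(* Defs.v *)
From mathcomp Require Import all_boot all_order all_algebra.
From mathcomp Require Import all_classical all_reals all_analysis.

Set Implicit Arguments.
Unset Strict Implicit.
Unset Printing Implicit Defensive.

Local Open Scope classical_set_scope.

(* omega^omega with the product topology of the discrete space nat. *)
Notation baire := {ptws nat -> nat}.

Definition graph (f : baire) : set (nat * nat) := range (fun n => (n, f n)).

(* An element p of omega^a is a function out of the type of the elements of a. *)
Definition pgraph (a : set nat) (p : a -> nat) : set (nat * nat) :=
  range (fun x : a => (val x, p x)).

Definition ad_family (A : set baire) : Prop :=
  forall f g, A f -> A g -> f <> g -> finite_set (graph f `&` graph g).

Definition mad_family (A : set baire) : Prop :=
  ad_family A /\
  forall f : baire, exists2 h, A h & infinite_set (graph f `&` graph h).

Definition I0 (A : set baire) : set (set nat) :=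
  [set a : set nat | exists p : a -> nat,
      forall h, A h -> finite_set (pgraph p `&` graph h)].

Definition almost_subset (x y : set nat) : Prop := finite_set (x `\` y).

(* Only the diagonalisation property: [set a | infinite_set a] `\` I0 A is
   always a coideal, because I0 A is closed under subsets and finite unions and
   contains the finite sets. *)
Definition p_coideal (F : set (set nat)) : Prop :=
  forall a : nat -> set nat,
    (forall n, F (a n)) -> (forall n, a n.+1 `<=` a n) ->
    exists2 b, F b & forall n, almost_subset b (a n).

(* Continuous images of omega^omega; the empty set, which is not one of them,
   is analytic by convention. *)
Definition analytic (A : set baire) : Prop :=
  A = set0 \/ exists2 f : baire -> baire, continuous f & range f = A.

(* Main.v *)
(* Suppose A is the range of a continuous F.  Fix a nonprincipal ultrafilter V
   on nat.  Relative to a set a outside I0 A, call C a null set if some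
   P : nat -> set nat with all P n in V satisfies P n (F z n) for only finitely
   many n in a, for each z in C.  Null sets form a sigma-ideal, and the whole
   space is not null, since a function p on a with p n in P n has infinite
   intersection with some member of A.  The P-coideal hypothesis yields one a
   that decides, for all countably many cylinders, whether they are null on a or
   on no smaller set outside I0 A.  Let K be the set of points all of whose
   cylinder neighbourhoods are non-null.  For z in K and n in a outside a set in
   I0 A, the values F w n of the points w of K near z form a set in V.  Two sets
   in V intersect, so starting from two points of K with different images one
   can build, by successive extension, two limit points whose images are distinct
   but agree infinitely often, against almost disjointness. *)
Require Import Defs.
From mathcomp Require Import all_boot all_order all_algebra.
From mathcomp Require Import all_classical all_reals all_analysis.

Local Open Scope classical_set_scope.

(** * Finite intersections of graphs and the ideal [I0] *)

Lemma finite_set_natP (S : set nat) :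
  finite_set S <-> exists m, forall n, S n -> (n < m)%N.
Proof.
split=> [/finite_seqP[s ->]|[m Sm]]; last exact: sub_finite_set Sm (finite_II m).
by exists (\max_(i <- s) i).+1 => n /= ns; rewrite ltnS; exact: leq_bigmax_seq.
Qed.

Lemma finite_set_pgraph (a : set nat) (p : nat -> nat) (h : baire) :
  finite_set (pgraph (fun x : a => p (val x)) `&` graph h) <->
  finite_set (a `&` [set n | p n = h n]).
Proof.
split=> fin.
  apply: sub_finite_set (finite_image fst fin) => n [an pn].
  exists (n, p n) => //; split; last by exists n; rewrite // pn.
  by exists (exist _ n (mem_set an)).
apply: sub_finite_set (finite_image (fun n => (n, p n)) fin) => _ [[x _ <-] [n _]].
case=> nx hp; exists n; last by rewrite nx.
by split; [rewrite nx; exact: set_valP | rewrite /= hp nx].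
Qed.

Lemma finite_set_graph (f g : baire) :
  finite_set (graph f `&` graph g) <-> finite_set [set n | f n = g n].
Proof.
split=> fin.
  apply: sub_finite_set (finite_image fst fin) => n /= fg.
  by exists (n, f n) => //; split; exists n; rewrite // fg.
apply: sub_finite_set (finite_image (fun n => (n, f n)) fin) => _ [[n _ <-] [k _]].
by case=> -> gf; exists n.
Qed.

(** Giving [p] the value 0 off [a] replaces functions on the subtype by total ones. *)
Lemma I0P (A : set baire) (a : set nat) :
  I0 A a <-> exists p : nat -> nat,
    forall h, A h -> finite_set (a `&` [set n | p n = h n]).
Proof.
split=> [[p pA]|[p pA]]; last first.
  by exists (fun x => p (val x)) => h /pA; exact: (iffRL (finite_set_pgraph a p h)).
pose q n := if pselect (a n) is left an then p (exist _ n (mem_set an)) else 0%N.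
have pq : p = fun x => q (val x).
  apply/funext => -[n an]; rewrite /q /=.
  case: pselect => [an'|]; last by move/set_mem: (an).
  by congr p; exact: val_inj.
exists q => h Ah; apply: (iffLR (finite_set_pgraph a q h)); rewrite -pq; exact: pA.
Qed.

Lemma I0_subset (A : set baire) (a b : set nat) : a `<=` b -> I0 A b -> I0 A a.
Proof.
move=> ab /I0P[p pA]; apply/I0P; exists p => h /pA; apply: sub_finite_set.
exact: setSI.
Qed.

Lemma I0_finite (A : set baire) (a : set nat) : finite_set a -> I0 A a.
Proof.
move=> fa; apply/I0P; exists id => h _.
exact: sub_finite_set (@subIsetl _ _ _) fa.
Qed.

Lemma I0_setU (A : set baire) (a b : set nat) :
  I0 A a -> I0 A b -> I0 A (a `|` b).
Proof.
move=> /I0P[p pA] /I0P[q qA]; apply/I0P.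
exists (fun n => if `[< a n >] then p n else q n) => h Ah.
have := conj (pA h Ah) (qA h Ah); rewrite -finite_setU; apply: sub_finite_set.
move=> n /= [abn]; case: asboolP => an e; first by left.
by right; split=> //; case: abn.
Qed.

Lemma mad_family_I0 (A : set baire) : mad_family A -> ~ I0 A setT.
Proof.
move=> [_ mad] /I0P[p pA]; have [h Ah inf] := mad p; apply: inf.
by apply/finite_set_graph; have := pA h Ah; rewrite setTI.
Qed.

(** Property [k] is handled at stage [k] of a decreasing sequence in [H], by passing to a subset
    satisfying [Q k] whenever one exists in [H]. An almost-intersection in [H] keeps every
    decision. *)
Lemma p_coideal_decide (H : set (set nat)) (Q : nat -> set nat -> Prop) :
  p_coideal H -> H setT ->
  (forall a b, H a -> almost_subset a b -> H (a `&` b)) ->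
  (forall k a b, Q k a -> almost_subset b a -> Q k b) ->
  exists2 a, H a & forall k, Q k a \/ forall b, H b -> b `<=` a -> ~ Q k b.
Proof.
move=> Hp HT HI Qsub.
pose decides k a := Q k a \/ forall b, H b -> b `<=` a -> ~ Q k b.
have step (x : nat * {a | H a}) : exists y : {a | H a},
    sval y `<=` sval x.2 /\ decides x.1 (sval y).
  case: x => k [a Ha] /=.
  have [[b [Hb ba Qb]]|no] := pselect (exists b, [/\ H b, b `<=` a & Q k b]).
    by exists (exist _ b Hb); split=> //; left.
  exists (exist _ a Ha); split=> //; right=> b Hb ba Qb; apply: no.
  by exists b.
have [g gP] := choice step.
pose fix s n : {a | H a} := if n is k.+1 then g (k, s k) else exist _ setT HT.
have [||b Hb bs] := Hp (fun n => sval (s n)).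
- by move=> n; exact: svalP.
- by move=> n; have [] := gP (n, s n).
exists b => // k; have [_ /= [Qs|noQ]] := gP (k, s k).
  by left; exact: Qsub Qs (bs k.+1).
(* Since [c] is only almost contained in the stage set, [noQ] is applied to its trace there, which
   differs from [c] by a finite set. *)
right=> c Hc cb Qc; have cs : almost_subset c (sval (s k.+1)).
  by apply: sub_finite_set (bs k.+1); exact: setSD.
apply: (noQ (c `&` sval (s k.+1))); [exact: HI| exact: subIsetr|].
by apply: Qsub Qc _; rewrite /almost_subset setIC -setIDA setDv setI0.
Qed.

(** * Cylinders, continuity and limits of extensions *)

Definition cylinder (s : seq nat) : set baire :=
  [set z : baire | mkseq z (size s) = s].

Definition agree (m : nat) (z w : nat -> nat) := forall i, (i < m)%N -> z i = w i.

Lemma agree_mkseq m (z w : nat -> nat) : mkseq w m = mkseq z m -> agree m z w.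
Proof. by move=> e i im; rewrite -(nth_mkseq 0%N z im) -e nth_mkseq. Qed.

(** Otherwise some [w m] agreeing with [z] below [m] all violate the equality. They converge to [z],
    so [F (w m) n] converges in a discrete space and is eventually [F z n]. *)
Lemma continuous_agree (F : baire -> baire) (z : baire) (n : nat) :
  continuous F -> exists m, forall w : baire, agree m z w -> F w n = F z n.
Proof.
move=> Fc; apply: contrapT => no.
have /choice[w wP] (m : nat) : exists w : baire, agree m z w /\ F w n <> F z n.
  apply: contrapT => no'; apply: no; exists m => w mw.
  by apply: contrapT => Fw; apply: no'; exists w.
have wz : {ptws, w @ \oo --> z}.
  apply/pointwise_cvgP => t; apply: cvg_near_cst.
  exists t.+1 => // m tm; rewrite /=; have [zw _] := wP m.
  by rewrite zw.
have Fwz : {ptws, F \o w @ \oo --> F z}.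
  exact: cvg_comp wz (Fc z).
have /pointwise_cvgP/(_ n) := Fwz.
move/(_ [set F z n] (discrete_set1 _)) => [m _ mP].
by have [_] := wP m; apply; exact: (mP m (leqnn m)).
Qed.

Lemma agree_limit (z : nat -> nat -> nat) (m : nat -> nat) :
  (forall k, (m k < m k.+1)%N) -> (forall k, agree (m k) (z k) (z k.+1)) ->
  exists u : nat -> nat, forall k, agree (m k) (z k) u.
Proof.
move=> mS zS.
have mono k d : (m k <= m (k + d))%N.
  elim: d => [|d IH]; first by rewrite addn0.
  by rewrite addnS; exact: leq_trans IH (ltnW (mS _)).
have zE k d : agree (m k) (z k) (z (k + d)%N).
  elim: d => [|d IH] i ik; first by rewrite addn0.
  by rewrite addnS -zS ?IH //; exact: leq_trans ik (mono k d).
have m_ge k : (k <= m k)%N.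
  by elim: k => // k IH; exact: leq_ltn_trans IH (mS k).
(* Coordinate [i] no longer changes from stage [i.+1] on, because [i < m i.+1]. *)
exists (fun i => z i.+1 i) => k i ik.
have [ki|ik'] := leqP k i.+1.
  by rewrite -(subnKC ki); exact: zE.
by rewrite -(subnKC (ltnW ik')) -zE.
Qed.

(** * The sigma-ideal of null sets *)

Definition null (V : set_system nat) (F : baire -> baire) (a : set nat)
    (C : set baire) :=
  exists2 P : nat -> set nat, forall n, a n -> V (P n) &
    forall z, C z -> finite_set (a `&` [set n | P n (F z n)]).

Lemma null_almost_subset (V : set_system nat) F a b C : Filter V ->
  null V F a C -> almost_subset b a -> null V F b C.
Proof.
(* Membership of [P n] in [V] is known only for [n] in [a]; elsewhere the implication yields the
   whole of [nat], at finitely many points of [b]. *)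
move=> FV [P VP Pfin] ba; exists (fun n => [set v | a n -> P n v]) => [n bn|z Cz].
  have [an|an] := pselect (a n); first by apply: filterS (VP n an) => v Pv _.
  by apply: filterS filterT => v _ /= an'; case: (an an').
have := conj ba (Pfin z Cz); rewrite -finite_setU; apply: sub_finite_set.
move=> n [bn /= Pn]; have [an|an] := pselect (a n); [right|left]; split=> //.
exact: Pn.
Qed.

Lemma null_subset V F a (C D : set baire) :
  C `<=` D -> null V F a D -> null V F a C.
Proof. by move=> CD [P VP Pfin]; exists P => // z /CD/Pfin. Qed.

Lemma null_bigcup (V : set_system nat) F a (C : nat -> set baire) : Filter V ->
  (forall k, null V F a (C k)) -> null V F a (\bigcup_k C k).
Proof.
move=> FV nC.
have /choice[P PP] k : exists P : nat -> set nat, (forall n, a n -> V (P n)) /\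
    forall z, C k z -> finite_set (a `&` [set n | P n (F z n)]).
  by have [P ? ?] := nC k; exists P.
(* Only the k < n are intersected at n, which leaves finitely many exceptions for
   each k. *)
exists (fun n => [set v | forall k, (k < n)%N -> P k n v]) => [n an|z [k _ Ckz]].
  have: forall j, V [set v | forall k, (k < j)%N -> P k n v].
    elim=> [|j IH]; first by apply: filterS filterT.
    have [/(_ n an) VP _] := PP j; apply: filterS (filterI IH VP) => v [IHv Pv] k.
    by rewrite ltnS leq_eqVlt => /predU1P[->|/IHv].
  exact.
have [_ /(_ z Ckz) fin] := PP k.
have := conj fin (finite_II k.+1); rewrite -finite_setU; apply: sub_finite_set.
move=> n [an /= Pn]; have [kn|nk] := ltnP k n; last by right.
by left; split=> //; exact: Pn.
Qed.

Lemma null_setU (V : set_system nat) F a (C D : set baire) : Filter V ->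
  null V F a C -> null V F a D -> null V F a (C `|` D).
Proof.
move=> FV nC nD.
have: null V F a (\bigcup_k (if k is 0%N then C else D)).
  by apply: null_bigcup => -[].
by apply: null_subset => z [Cz|Dz]; [exists 0%N | exists 1%N].
Qed.

(** Members of a proper filter are nonempty, so a function choosing [p n] in [P n] on [a] meets each
    [F z] finitely often there. *)
Lemma null_I0 (V : set_system nat) (F : baire -> baire) a : ProperFilter V ->
  null V F a setT -> I0 (range F) a.
Proof.
move=> FV [P VP Pfin]; apply/I0P.
have /choice[p pP] n : exists v, a n -> P n v.
  have [an|an] := pselect (a n); last by exists 0%N.
  by have [v Pv] := filter_ex (VP n an); exists v.
exists p => _ [z _ <-]; apply: sub_finite_set (Pfin z I) => n [an /= <-].
by split=> //; exact: pP.
Qed.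

(** * The kernel: points with no null cylinder around them *)

Definition kernel (V : set_system nat) F (a : set nat) : set baire :=
  [set z : baire | forall m, ~ null V F a (cylinder (mkseq z m))].

Lemma null_setC_kernel (V : set_system nat) F a : Filter V ->
  null V F a (~` kernel V F a).
Proof.
(* The default [[::]] for invalid codes is harmless: [C k] is empty unless its cylinder is null. *)
move=> FV; pose cyl k := cylinder (odflt [::] (unpickle k)).
pose C k := [set z | cyl k z /\ null V F a (cyl k)].
have: null V F a (\bigcup_k C k).
  apply: null_bigcup => k; have [nk|nk] := pselect (null V F a (cyl k)).
    by apply: null_subset nk => z [].
  exists (fun=> setT) => [n _|z [_ /nk//]]; exact: filterT.
apply: null_subset => z /existsNP[m /contrapT nm]; exists (pickle (mkseq z m)) => //.
by rewrite /C /cyl pickleK /=; split=> //; rewrite /cylinder /= size_mkseq.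
Qed.

Definition decided V F (H : set (set nat)) (a : set nat) :=
  forall s, null V F a (cylinder s) \/
    forall b, H b -> b `<=` a -> ~ null V F b (cylinder s).

(** On the exceptional set [b], the complements of the sections lie in the ultrafilter and witness
    that the kernel part of the cylinder is null. The rest of the cylinder is null too, against the
    decision made by [a]. *)
Lemma kernel_section (V : set_system nat) F (H : set (set nat)) a (z : baire) m :
  UltraFilter V -> decided V F H a -> kernel V F a z ->
  ~ H (a `&` [set n | ~ V [set F w n | w in
                         kernel V F a `&` cylinder (mkseq z m)]]).
Proof.
move=> UV dec Kz; pose S n := [set F w n | w in kernel V F a `&` cylinder (mkseq z m)].
set b := a `&` _ => Hb.
have [//|/(_ _ Hb (@subIsetl _ _ _))] := dec (mkseq z m); first exact: Kz.
apply.
have nC : null V F b (~` kernel V F a).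
  apply: null_almost_subset (null_setC_kernel _ _ _ _) _.
  by rewrite /almost_subset /b setIC -setIDA setDv setI0.
have nK : null V F b (kernel V F a `&` cylinder (mkseq z m)).
  exists (fun n => ~` S n) => [n [_ nV]|w Kw].
    by have [/nV|] := in_ultra_setVsetC (S n) UV.
  apply: sub_finite_set (finite_set0 _) => n [_ /=]; apply.
  by exists w.
apply: null_subset (null_setU _ _ _ _ _ _ nC nK) => w Cw.
by have [Kw|] := pselect (kernel V F a w); [right | left].
Qed.

(** As [a] is not in [I0 A], some [n >= m] in [a] avoids both exceptional sets; the two sections at
    [n] lie in [V] and share a value. *)
Lemma kernel_meet (V : set_system nat) F (A : set baire) a (z w : baire) m :
  UltraFilter V -> ~ I0 A a -> decided V F (~` I0 A) a ->
  kernel V F a z -> kernel V F a w ->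
  exists n (z' w' : baire), [/\ (m <= n)%N,
    kernel V F a z' /\ kernel V F a w',
    agree m z z' /\ agree m w w' & F z' n = F w' n].
Proof.
move=> UV aA dec Kz Kw; apply: contrapT => no; apply: aA.
have /contrapT Iz := kernel_section V F _ a z m UV dec Kz.
have /contrapT Iw := kernel_section V F _ a w m UV dec Kw.
apply: I0_subset (I0_setU _ _ _ (I0_finite A _ (finite_II m)) (I0_setU _ _ _ Iz Iw)).
move=> n an; have [mn|nm] := leqP m n; last by left.
right; apply: contrapT => /not_orP[/not_andP[//|/contrapT Vz] /not_andP[//|/contrapT Vw]].
have [v [[z' [Kz' Cz'] Fz'] [w' [Kw' Cw'] Fw']]] := filter_ex (filterI Vz Vw).
move: Cz' Cw'; rewrite /cylinder /= !size_mkseq => /agree_mkseq zz' /agree_mkseq ww'.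
by apply: no; exists n, z', w'; split=> //; rewrite Fz' Fw'.
Qed.

Lemma kernel_nontrivial (V : set_system nat) F a :
  ProperFilter V -> (forall x, V (~` [set x])) -> ~ I0 (range F) a ->
  exists z w, [/\ kernel V F a z, kernel V F a w & F z <> F w].
Proof.
move=> FV Vx aA; apply: contrapT => no; apply: aA; apply: (null_I0 V).
have nK : null V F a (kernel V F a).
  have [[z0 Kz0]|no0] := pselect (exists z, kernel V F a z); last first.
    by exists (fun=> setT) => [n _|z Kz]; [exact: filterT | case: no0; exists z].
  (* If [F] is constant on the kernel, removing its single value at each [n] makes the kernel
     null. *)
  exists (fun n => ~` [set F z0 n]) => // z Kz.
  apply: sub_finite_set (finite_set0 _) => n [_ /=]; apply.
  by apply: contrapT => zn; apply: no; exists z, z0; split=> // e; apply: zn; rewrite e.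
apply: null_subset (null_setU _ _ _ _ _ _ nK (null_setC_kernel V F a _)) => z _.
exact: lem.
Qed.

Lemma kernel_absurd (V : set_system nat) F a :
  UltraFilter V -> (forall x, V (~` [set x])) -> continuous F ->
  ad_family (range F) -> ~ I0 (range F) a -> ~ decided V F (~` I0 (range F)) a.
Proof.
move=> UV Vx Fc ad aA dec.
have [z0 [w0 [Kz0 Kw0 zw0]]] := kernel_nontrivial V F a _ Vx aA.
have [k0 zwk] : exists k, F z0 k <> F w0 k.
  by apply/existsNP => e; apply: zw0; exact/funext.
have [mz mzP] := continuous_agree F z0 k0 Fc.
have [mw mwP] := continuous_agree F w0 k0 Fc.
pose K := {zw : baire * baire | kernel V F a zw.1 /\ kernel V F a zw.2}.
pose R (x y : K * nat) := [/\ (x.2 < y.2)%N,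
  agree x.2 (sval x.1).1 (sval y.1).1 /\ agree x.2 (sval x.1).2 (sval y.1).2 &
  exists2 n, (x.2 <= n)%N & forall u v : baire,
    agree y.2 (sval y.1).1 u -> agree y.2 (sval y.1).2 v -> F u n = F v n].
have step x : {y | R x y}.
  apply: cid; case: x => -[[z w] /= [Kz Kw]] m.
  have [n [z' [w' [mn K' [zz' ww'] Fn]]]] := kernel_meet V F _ a z w m UV aA dec Kz Kw.
  have [m1 m1P] := continuous_agree F z' n Fc.
  have [m2 m2P] := continuous_agree F w' n Fc.
  (* The length covers both continuity moduli at [n]; the successor makes it strictly larger than
     [m]. *)
  exists (exist _ (z', w') K', (maxn m (maxn m1 m2)).+1); split=> //=.
    by rewrite ltnS leq_maxl.
  exists n => // u v zu wv; rewrite (m1P u) 1?(m2P v) // => i ilt; [apply: wv|apply: zu];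
    by rewrite ltnS !leq_max (ltnW ilt) ?orbT.
(* The initial length [maxn mz mw] freezes the differing values at [k0], so the limits have distinct
   images. *)
have [f [f0 fS]] := dependent_choice step
  (exist _ (z0, w0) (conj Kz0 Kw0) : K, maxn mz mw).
have m_lt k : ((f k).2 < (f k.+1).2)%N by have [] := fS k.
have [z zP] : exists u : baire, forall k, agree (f k).2 (sval (f k).1).1 u.
  by apply: agree_limit => // k; have [_ []] := fS k.
have [w wP] : exists u : baire, forall k, agree (f k).2 (sval (f k).1).2 u.
  by apply: agree_limit => // k; have [_ []] := fS k.
have zk : F z k0 = F z0 k0.
  apply: mzP => i ilt; have := zP 0%N i; rewrite f0 /= leq_max ilt; exact.
have wk : F w k0 = F w0 k0.
  apply: mwP => i ilt; have := wP 0%N i; rewrite f0 /= leq_max ilt orbT; exact.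
have Fzw : F z <> F w by move=> e; apply: zwk; rewrite -zk -wk e.
have /finite_set_graph/finite_set_natP[N NP] :=
  ad (F z) (F w) (imageT F z) (imageT F w) Fzw.
have m_ge k : (k <= (f k).2)%N.
  by elim: k => // k IH; exact: leq_ltn_trans IH (m_lt k).
(* Stage [N] provides an agreement at some [n >= N], beyond the supposed bound. *)
have [_ _ [n Nn /(_ z w (zP _) (wP _))/NP]] := fS N.
by rewrite ltnNge (leq_trans (m_ge N) Nn).
Qed.

Theorem theorem7 (A : set baire) :
  mad_family A ->
  p_coideal ([set a : set nat | infinite_set a] `\` I0 A) ->
  ~ analytic A.
Proof.
move=> mad Hp [A0|[F Fc FA]].
  by have [_ /(_ id) [h]] := mad; rewrite A0.
have HE : [set a : set nat | infinite_set a] `\` I0 A = ~` I0 A.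
  apply/seteqP; split=> a; first by case.
  by move=> nI; split=> // fa; apply: nI; exact: I0_finite.
(* Extending the Fréchet filter makes [V] nonprincipal. *)
rewrite {}HE in Hp; have [V [UV fV]] := ultraFilterLemma frechet_properfilter_nat.
have Vx x : V (~` [set x]) by apply: fV; rewrite /frechet_filter /= setCK.
have [|a b Ha ab Iab|k a b|a aA dec] := p_coideal_decide (~` I0 A)
  (fun k a => null V F a (cylinder (odflt [::] (unpickle k)))) Hp.
- exact: mad_family_I0.
- apply: Ha; apply: I0_subset (I0_setU _ _ _ (I0_finite A _ ab) Iab) => n an.
  by have [bn|bn] := pselect (b n); [right | left].
- exact: null_almost_subset.
apply: (kernel_absurd V F a) => //; first by rewrite FA; have [] := mad.
  by rewrite FA.
by move=> s; rewrite FA; have := dec (pickle s); rewrite pickleK.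
Qed.
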